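(* The full centre of an algebra is Morita invariant: if $A$ and $B$ are Morita equivalent algebras in a (strict) monoidal category $\mathcal{C}$ whose full centres exist, then the full centres $Z(A)$ and $Z(B)$ are isomorphic as algebras in the monoidal centre $\mathcal{Z}(\mathcal{C})$.
   Context: Monoidal categories are strict; algebras $(A,\mu,\iota)$ are associative and unital. Monoidal centre: $\mathcal{Z}(\mathcal{C})$ is the category of pairs $(Z,z)$ with $Z\in\mathcal{C}$ and $z_X:Z\otimes X\to X\otimes Z$ natural isomorphisms with $z_I=1$ and $z_{X\otimes Y}=(X\otimes z_Y)(z_X\otimes Y)$; morphisms are morphisms in $\mathcal{C}$ compatible with half-braidings; $(Z,z)\otimes(W,w)=(Z\otimes W,z|w)$, $(z|w)_X=(z_X\otimes W)(Z\otimes w_X)$; braiding $c_{(X,x),(Y,y)}=x_Y$. Full centre $Z(A)$ of $A$: the terminal object of the category of pairs $(Z,\zeta)$ with $(Z,z)\in\mathcal{Z}(\mathcal{C})$ and $\zeta:Z\to A$ a morphism in $\mathcal{C}$ such that $\mu(\zeta\otimes A)=\mu(A\otimes\zeta)z_A$ (morphisms: morphisms in $\mathcal{Z}(\mathcal{C})$ commuting with the maps to $A$). It carries the unique algebra structure in $\mathcal{Z}(\mathcal{C})$ for which $Z(A)\to A$ is a homomorphism of algebras in $\mathcal{C}$. For an algebra $A$, $\mathcal{C}_A$ is the category of (unital, associative) right $A$-modules $(M,\nu:M\otimes A\to M)$ in $\mathcal{C}$; it is a left $\mathcal{C}$-module category via $X*(M,\nu)=(X\otimes M,X\otimes\nu)$.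 A $\mathcal{C}$-module functor $F:\mathcal{M}\to\mathcal{N}$ between left $\mathcal{C}$-module categories is a functor with natural isomorphisms $F(X*M)\to X*F(M)$ compatible with the associativity constraints of the actions (and with the unit). Algebras $A,B$ in $\mathcal{C}$ are Morita equivalent if $\mathcal{C}_A$ and $\mathcal{C}_B$ are equivalent as $\mathcal{C}$-module categories. *)

(* Defs.v *)
From Stdlib Require Import ssreflect ssrbool.
From Stdlib Require Import FunctionalExtensionality ProofIrrelevance
  IndefiniteDescription.

Set Implicit Arguments.
Unset Strict Implicit.
Unset Printing Implicit Defensive.

(* The hom-sets [Hom X Y] of a category are subsets of one type [Mor] of arrows,
  on which composition is a total operation that is meaningful, and subject to
  the axioms, on composable arrows only.  A strict monoidal category then has
  [(X ⊗ Y) ⊗ Z = X ⊗ (Y ⊗ Z)] as an equality of objects, and the strict formulas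
  of the subject can be written without transporting arrows along it.
  Hom-sets of distinct pairs of objects are allowed to overlap (a morphism of
  modules is represented by the underlying arrow of the base category), hence
  a functor acts on triples made of a source, a target and an arrow. *)

Record category := Category {
  Ob : Type;
  Mor : Type;
  Hom : Ob -> Ob -> Mor -> Prop;
  idm : Ob -> Mor;
  comp : Mor -> Mor -> Mor;
  hom_id : forall X, Hom X X (idm X);
  hom_comp : forall X Y Z f g, Hom X Y f -> Hom Y Z g -> Hom X Z (comp g f);
  comp_idl : forall X Y f, Hom X Y f -> comp (idm Y) f = f;
  comp_idr : forall X Y f, Hom X Y f -> comp f (idm X) = f;
  comp_assoc : forall W X Y Z f g h, Hom W X f -> Hom X Y g -> Hom Y Z h ->
    comp h (comp g f) = comp (comp h g) f
}.
Arguments Hom {c}.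
Arguments idm {c}.
Arguments comp {c}.

Notation "g ∘ f" := (comp g f) (at level 40, left associativity).

Definition inverse_pair (K : category) (X Y : Ob K) (f g : Mor K) : Prop :=
  [/\ Hom X Y f, Hom Y X g, g ∘ f = idm X & f ∘ g = idm Y].

Definition is_iso (K : category) (X Y : Ob K) (f : Mor K) : Prop :=
  exists g, inverse_pair X Y f g.

Definition isomorphic (K : category) (X Y : Ob K) : Prop :=
  exists f, is_iso X Y f.

Definition is_terminal (K : category) (T : Ob K) : Prop :=
  forall X, exists! f, Hom X T f.

Record functor (K L : category) := Functor {
  fob : Ob K -> Ob L;
  fmor : Ob K -> Ob K -> Mor K -> Mor L;
  hom_fmor : forall X Y f, Hom X Y f -> Hom (fob X) (fob Y) (fmor X Y f);
  fmor_id : forall X, fmor X X (idm X) = idm (fob X);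
  fmor_comp : forall X Y Z f g, Hom X Y f -> Hom Y Z g ->
    fmor X Z (g ∘ f) = fmor Y Z g ∘ fmor X Y f
}.

Definition functor_id (K : category) : functor K K.
Proof. by exists (fun X => X) (fun _ _ f => f). Defined.

Definition functor_comp (K L M : category) (G : functor L M) (F : functor K L) :
  functor K M.
Proof.
exists (fun X => fob G (fob F X))
       (fun X Y f => fmor G (fob F X) (fob F Y) (fmor F X Y f)).
- by move=> X Y f Hf; do 2! apply: hom_fmor.
- by move=> X; rewrite !fmor_id.
- move=> X Y Z f g Hf Hg; rewrite (fmor_comp _ Hf Hg).
  by apply: fmor_comp; apply: hom_fmor.
Defined.

Definition nat_iso (K L : category) (F G : functor K L) : Prop :=
  exists t : Ob K -> Mor L,
    (forall X, is_iso (fob F X) (fob G X) (t X)) /\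
    (forall X Y f, Hom X Y f -> t Y ∘ fmor F X Y f = fmor G X Y f ∘ t X).

Definition is_equivalence (K L : category) (F : functor K L) : Prop :=
  exists G : functor L K,
    nat_iso (functor_comp G F) (functor_id K) /\
    nat_iso (functor_comp F G) (functor_id L).

(* As [⊗] is defined on all arrows, the associativity and unit laws [tensmA],
   [tensm1l], [tensm1r] need no typing hypothesis: objects and arrows form
   monoids under [⊗]. *)
Record strict_monoidal := StrictMonoidal {
  mcat :> category;
  tens : Ob mcat -> Ob mcat -> Ob mcat;
  I_ : Ob mcat;
  tensm : Mor mcat -> Mor mcat -> Mor mcat;
  hom_tensm : forall X X' Y Y' f g, Hom X X' f -> Hom Y Y' g ->
    Hom (tens X Y) (tens X' Y') (tensm f g);
  tensm_id : forall X Y, tensm (idm X) (idm Y) = idm (tens X Y);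
  tensm_comp : forall X X' X'' Y Y' Y'' f f' g g',
    Hom X X' f -> Hom X' X'' f' -> Hom Y Y' g -> Hom Y' Y'' g' ->
    tensm (f' ∘ f) (g' ∘ g) = tensm f' g' ∘ tensm f g;
  tensA : forall X Y Z, tens X (tens Y Z) = tens (tens X Y) Z;
  tens1l : forall X, tens I_ X = X;
  tens1r : forall X, tens X I_ = X;
  tensmA : forall f g h, tensm f (tensm g h) = tensm (tensm f g) h;
  tensm1l : forall f, tensm (idm I_) f = f;
  tensm1r : forall f, tensm f (idm I_) = f
}.
Arguments tens {s}.
Arguments I_ {s}.
Arguments tensm {s}.

Notation "X ⊗ Y" := (tens X Y) (at level 38, left associativity).
Notation "f ⊠ g" := (tensm f g) (at level 38, left associativity).
(* [X ◁ f] and [f ▷ X] are what is usually written $X\otimes f$, $f\otimes X$ *)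
Notation "X ◁ f" := (tensm (idm X) f) (at level 37, right associativity).
Notation "f ▷ X" := (tensm f (idm X)) (at level 36, left associativity).

Record algebra (C : strict_monoidal) := Algebra {
  aob : Ob C;
  mul : Mor C;
  one : Mor C;
  hom_mul : Hom (aob ⊗ aob) aob mul;
  hom_one : Hom I_ aob one;
  mul_assoc : mul ∘ (mul ▷ aob) = mul ∘ (aob ◁ mul);
  mul_onel : mul ∘ (one ▷ aob) = idm aob;
  mul_oner : mul ∘ (aob ◁ one) = idm aob
}.

Definition alg_hom (C : strict_monoidal) (A B : algebra C) (f : Mor C) : Prop :=
  [/\ Hom (aob A) (aob B) f,
      f ∘ mul A = mul B ∘ (f ⊠ f)
    & f ∘ one A = one B].

Section Typing.
Variable C : strict_monoidal.

Lemma hom_cast (X X' Y Y' : Ob C) f :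
  Hom X Y f -> X = X' -> Y = Y' -> Hom X' Y' f.
Proof. by move=> H <- <-. Qed.

Lemma hom_comp' (X Y Y' Z : Ob C) f g :
  Hom X Y f -> Hom Y' Z g -> Y = Y' -> Hom X Z (g ∘ f).
Proof. by move=> Hf Hg E; subst; apply: hom_comp Hg. Qed.

Lemma compA (W X X' Y Y' Z : Ob C) f g h :
  Hom W X f -> Hom X' Y g -> Hom Y' Z h -> X = X' -> Y = Y' ->
  h ∘ (g ∘ f) = (h ∘ g) ∘ f.
Proof. by move=> Hf Hg Hh ??; subst; apply: comp_assoc; eassumption. Qed.

Lemma comp1l (X Y Y' : Ob C) f : Hom X Y f -> Y = Y' -> idm Y' ∘ f = f.
Proof. by move=> H <-; apply: comp_idl H. Qed.

Lemma comp1r (X X' Y : Ob C) f : Hom X Y f -> X = X' -> f ∘ idm X' = f.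
Proof. by move=> H <-; apply: comp_idr H. Qed.

Lemma tensmC (X X1 X2 X' Y Y1 Y2 Y' : Ob C) f f' g g' :
  Hom X X1 f -> Hom X2 X' f' -> X1 = X2 ->
  Hom Y Y1 g -> Hom Y2 Y' g' -> Y1 = Y2 ->
  (f' ⊠ g') ∘ (f ⊠ g) = (f' ∘ f) ⊠ (g' ∘ g).
Proof. by move=> ?????? ; subst; symmetry; apply: tensm_comp; eassumption. Qed.

End Typing.

Ltac objs := rewrite ?tensA ?tens1l ?tens1r; reflexivity.

Ltac synth :=
  lazymatch goal with
  | |- Hom _ _ (idm _) => apply: hom_id
  | |- Hom _ _ (_ ∘ _) => eapply hom_comp'; [synth | synth | objs]
  | |- Hom _ _ (_ ⊠ _) => eapply hom_tensm; synth
  | |- Hom _ _ _ => first [ eassumption | solve [eauto 2 with homs] ]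
  end.

Ltac typ :=
  lazymatch goal with
  | |- Hom _ _ _ => eapply hom_cast; [synth | objs | objs]
  end.

Ltac sides := first [synth | objs].

(* [assr]: reassociate all composites to the right; [pull a b]: expose the
   composite [a ∘ b] in a chain associated to the right. *)
Ltac assr :=
  repeat match goal with
  | |- context [?h ∘ ?g ∘ ?f] =>
    let E := fresh in
    assert (E : h ∘ g ∘ f = h ∘ (g ∘ f)) by (symmetry; eapply compA; sides);
    rewrite E; clear E
  end.

Ltac pull h g :=
  match goal with
  | |- context [h ∘ (g ∘ ?f)] =>
    let E := fresh in
    assert (E : h ∘ (g ∘ f) = (h ∘ g) ∘ f) by (eapply compA; sides);
    rewrite E; clear E
  end.

Section Whiskering.
Variable C : strict_monoidal.

Lemma whl_comp (T X Y Y' Z : Ob C) f g :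
  Hom X Y f -> Hom Y' Z g -> Y = Y' -> T ◁ (g ∘ f) = T ◁ g ∘ T ◁ f.
Proof.
move=> Hf Hg E; subst.
by rewrite -(tensm_comp (hom_id T) (hom_id T) Hf Hg) (comp_idl (hom_id T)).
Qed.

Lemma whr_comp (T X Y Y' Z : Ob C) f g :
  Hom X Y f -> Hom Y' Z g -> Y = Y' -> (g ∘ f) ▷ T = g ▷ T ∘ f ▷ T.
Proof.
move=> Hf Hg E; subst.
by rewrite -(tensm_comp Hf Hg (hom_id T) (hom_id T)) (comp_idl (hom_id T)).
Qed.

Lemma slidel (X X' Y Y' T : Ob C) f g :
  Hom X X' f -> Hom Y Y' g -> X' = T -> (T ◁ g) ∘ (f ▷ Y) = f ⊠ g.
Proof.
move=> Hf Hg <-.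
by rewrite -(tensm_comp Hf (hom_id _) (hom_id Y) Hg) (comp_idl Hf) (comp_idr Hg).
Qed.

Lemma slider (X X' Y Y' T : Ob C) f g :
  Hom X X' f -> Hom Y Y' g -> Y' = T -> (f ▷ T) ∘ (X ◁ g) = f ⊠ g.
Proof.
move=> Hf Hg <-.
by rewrite -(tensm_comp (hom_id X) Hf Hg (hom_id _)) (comp_idr Hf) (comp_idl Hg).
Qed.

End Whiskering.

Ltac whisk :=
  repeat match goal with
  | |- context [idm ?T ⊠ (?g ∘ ?f)] =>
    let E := fresh in
    assert (E : T ◁ (g ∘ f) = T ◁ g ∘ T ◁ f) by (eapply whl_comp; sides);
    rewrite E; clear E
  | |- context [(?g ∘ ?f) ⊠ idm ?T] =>
    let E := fresh in
    assert (E : (g ∘ f) ▷ T = g ▷ T ∘ f ▷ T) by (eapply whr_comp; sides);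
    rewrite E; clear E
  end.

#[global] Hint Resolve hom_mul hom_one : homs.

Section AlgebraCategory.
Variable C : strict_monoidal.

Fact alg_hom_id (A : algebra C) : alg_hom A A (idm (aob A)).
Proof.
split; first exact: hom_id.
- rewrite tensm_id (comp1l (hom_mul A)) //.
  by rewrite (comp1r (hom_mul A)).
- by rewrite (comp1l (hom_one A)).
Qed.

Fact alg_hom_comp (A B D : algebra C) (f g : Mor C) :
  alg_hom A B f -> alg_hom B D g -> alg_hom A D (g ∘ f).
Proof.
move=> [Hf mf uf] [Hg mg ug]; split; first exact: hom_comp Hg.
- rewrite -(comp_assoc (hom_mul A) Hf Hg) mf.
  pull g (mul B); rewrite mg; assr.
  by rewrite (tensm_comp Hf Hg Hf Hg).
- by rewrite -(comp_assoc (hom_one A) Hf Hg) uf ug.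
Qed.

Definition algebras : category.
Proof.
refine (@Category (algebra C) (Mor C) (@alg_hom C) (fun A => idm (aob A))
          (@comp C) alg_hom_id alg_hom_comp _ _ _).
- by move=> A B f [Hf _ _]; apply: comp_idl Hf.
- by move=> A B f [Hf _ _]; apply: comp_idr Hf.
- move=> A B D E f g h [Hf _ _] [Hg _ _] [Hh _ _].
  exact: comp_assoc Hf Hg Hh.
Defined.

End AlgebraCategory.

Record half_braided (C : strict_monoidal) := HalfBraided {
  hob : Ob C;
  hb : Ob C -> Mor C;
  hb_iso : forall X, is_iso (hob ⊗ X) (X ⊗ hob) (hb X);
  hb_nat : forall X Y f, Hom X Y f -> hb Y ∘ (hob ◁ f) = (f ▷ hob) ∘ hb X;
  hb_unit : hb I_ = idm hob;
  hb_tens : forall X Y, hb (X ⊗ Y) = (X ◁ hb Y) ∘ (hb X ▷ Y)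
}.

Section Centre.
Variable C : strict_monoidal.

Lemma hom_hb (Z : half_braided C) X : Hom (hob Z ⊗ X) (X ⊗ hob Z) (hb Z X).
Proof. by case: (hb_iso Z X) => g []. Qed.

Lemma half_braided_eq (Z W : half_braided C) :
  hob Z = hob W -> (forall X, hb Z X = hb W X) -> Z = W.
Proof.
case: Z W => [Z z a b c d] [W w a' b' c' d'] /= E /functional_extensionality e.
by subst; f_equal; apply: proof_irrelevance.
Qed.

Definition centre_hom (Z W : half_braided C) (f : Mor C) : Prop :=
  Hom (hob Z) (hob W) f /\ forall X, (X ◁ f) ∘ hb Z X = hb W X ∘ (f ▷ X).

Hint Resolve hom_hb : homs.

Definition centre_cat : category.
Proof.
refine (@Category (half_braided C) (Mor C) centre_hom (fun Z => idm (hob Z))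
          (@comp C) _ _ _ _ _).
- move=> Z; split=> [|X]; first exact: hom_id.
  by rewrite !tensm_id (comp1l (hom_hb Z X)) // (comp1r (hom_hb Z X)).
- move=> X Y Z f g [Hf Ef] [Hg Eg]; split=> [|T]; first exact: hom_comp Hg.
  whisk; assr; rewrite Ef.
  by pull (T ◁ g) (hb Y T); rewrite Eg; assr.
- by move=> A B f [Hf _]; apply: comp_idl Hf.
- by move=> A B f [Hf _]; apply: comp_idr Hf.
- move=> A B D E f g h [Hf _] [Hg _] [Hh _].
  exact: comp_assoc Hf Hg Hh.
Defined.

Definition centre_unit : half_braided C.
Proof.
exists I_ (fun X => idm X).
- move=> X; rewrite tens1l tens1r; exists (idm X).
  by split; rewrite ?(comp_idl (hom_id X)) //; apply: hom_id.
- move=> X Y f Hf.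
  by rewrite tensm1l tensm1r (comp_idl Hf) (comp_idr Hf).
- by [].
- by move=> X Y; rewrite !tensm_id (comp_idl (hom_id _)).
Defined.

Lemma is_iso_comp (K : category) (X Y Z : Ob K) f g :
  is_iso X Y f -> is_iso Y Z g -> is_iso X Z (g ∘ f).
Proof.
move=> [f' [Hf Hf' e1 e2]] [g' [Hg Hg' e3 e4]]; exists (f' ∘ g').
split; [exact: hom_comp Hg | exact: hom_comp Hf' | |].
- rewrite -(comp_assoc (hom_comp Hf Hg) Hg' Hf') (comp_assoc Hf Hg Hg') e3.
  by rewrite (comp_idl Hf).
- rewrite -(comp_assoc (hom_comp Hg' Hf') Hf Hg) (comp_assoc Hg' Hf' Hf) e2.
  by rewrite (comp_idl Hg').
Qed.

Lemma is_iso_tensm (X X' Y Y' : Ob C) f g :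
  is_iso X X' f -> is_iso Y Y' g -> is_iso (X ⊗ Y) (X' ⊗ Y') (f ⊠ g).
Proof.
move=> [f' [Hf Hf' e1 e2]] [g' [Hg Hg' e3 e4]]; exists (f' ⊠ g').
split; [exact: hom_tensm | exact: hom_tensm | |].
- by rewrite -(tensm_comp Hf Hf' Hg Hg') e1 e3 tensm_id.
- by rewrite -(tensm_comp Hf' Hf Hg' Hg) e2 e4 tensm_id.
Qed.

Lemma is_iso_id (K : category) (X : Ob K) : is_iso X X (idm X).
Proof.
exists (idm X).
by split; rewrite ?(comp_idl (hom_id X)) //; apply: hom_id.
Qed.

Definition centre_tens (Z W : half_braided C) : half_braided C.
Proof.
exists (hob Z ⊗ hob W)
       (fun X => (hb Z X ▷ hob W) ∘ (hob Z ◁ hb W X)).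
- move=> X; apply: (@is_iso_comp _ _ (hob Z ⊗ (X ⊗ hob W))).
  + rewrite -tensA; apply: is_iso_tensm (is_iso_id _) (hb_iso W X).
  + rewrite !tensA; apply: is_iso_tensm (hb_iso Z X) (is_iso_id _).
- move=> X Y f Hf.
  rewrite -tensm_id -tensmA; assr.
  have EW : hob Z ◁ hb W Y ∘ hob Z ◁ hob W ◁ f
          = hob Z ◁ f ▷ hob W ∘ hob Z ◁ hb W X.
    transitivity (hob Z ◁ (hb W Y ∘ (hob W ◁ f))); first by whisk.
    by rewrite (hb_nat W Hf); whisk.
  have EZ : hb Z Y ▷ hob W ∘ hob Z ◁ f ▷ hob W
          = f ▷ hob Z ▷ hob W ∘ hb Z X ▷ hob W.
    transitivity ((hb Z Y ∘ (hob Z ◁ f)) ▷ hob W).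
      by whisk; rewrite tensmA.
    by rewrite (hb_nat Z Hf); whisk.
  rewrite EW; pull (hb Z Y ▷ hob W) (hob Z ◁ f ▷ hob W).
  by rewrite EZ; assr; rewrite -tensmA tensm_id.
- by rewrite !hb_unit !tensm_id (comp_idl (hom_id _)).
- move=> X Y; rewrite !hb_tens; whisk; assr.
  rewrite !tensmA; congr comp.
  pull (hb Z X ▷ Y ▷ hob W) (hob Z ◁ idm X ⊠ hb W Y).
  pull (X ◁ idm (hob Z) ⊠ hb W Y) (hb Z X ▷ hob W ▷ Y).
  congr comp; rewrite !tensm_id -(tensmA _ _ (idm _)) -tensmA !tensm_id.
  by erewrite slider, slidel; try sides.
Defined.

Fact centre_tensA (X Y Z : half_braided C) :
  centre_tens X (centre_tens Y Z) = centre_tens (centre_tens X Y) Z.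
Proof.
apply: half_braided_eq => [|T] /=; first exact: tensA.
by rewrite -!tensm_id; whisk; assr; rewrite !tensmA.
Qed.

Fact centre_tens1l (Z : half_braided C) : centre_tens centre_unit Z = Z.
Proof.
apply: half_braided_eq => [|T] /=; first exact: tens1l.
by rewrite tensm_id tensm1l; erewrite comp1l; try sides.
Qed.

Fact centre_tens1r (Z : half_braided C) : centre_tens Z centre_unit = Z.
Proof.
apply: half_braided_eq => [|T] /=; first exact: tens1r.
by rewrite tensm_id tensm1r; erewrite comp1r; try sides.
Qed.

Fact centre_hom_tensm (X X' Y Y' : half_braided C) f g :
  centre_hom X X' f -> centre_hom Y Y' g ->
  centre_hom (centre_tens X Y) (centre_tens X' Y') (f ⊠ g).
Proof.
move=> [Hf Ef] [Hg Eg]; split=> [|T] /=; first exact: hom_tensm.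
have E1 : (T ◁ (f ⊠ g)) ∘ (hb X T ▷ hob Y)
        = (hb X' T ▷ hob Y') ∘ (f ▷ T ⊠ g).
  rewrite tensmA; erewrite tensmC; try sides.
  rewrite Ef (comp_idr Hg); erewrite tensmC; try sides.
  by rewrite (comp_idl Hg).
have E2 : (f ▷ T ⊠ g) ∘ (hob X ◁ hb Y T)
        = (hob X' ◁ hb Y' T) ∘ (f ⊠ g ▷ T).
  rewrite -tensmA; erewrite tensmC; try sides.
  rewrite Eg (comp_idr Hf); erewrite tensmC; try sides.
  by rewrite (comp_idl Hf).
pull (T ◁ (f ⊠ g)) (hb X T ▷ hob Y).
by rewrite E1; assr; rewrite E2 tensmA.
Qed.

Definition centre : strict_monoidal.
Proof.
refine (@StrictMonoidal centre_cat centre_tens centre_unit (@tensm C)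
  centre_hom_tensm _ _ centre_tensA centre_tens1l centre_tens1r _ _ _).
- by move=> X Y; apply: tensm_id.
- move=> X X' X'' Y Y' Y'' f f' g g' [Hf _] [Hf' _] [Hg _] [Hg' _].
  exact: tensm_comp Hf Hf' Hg Hg'.
- by move=> f g h; apply: tensmA.
- by move=> f; apply: tensm1l.
- by move=> f; apply: tensm1r.
Defined.

Definition underlying_algebra (R : algebra centre) : algebra C :=
  @Algebra C (hob (aob R)) (mul R) (one R) (proj1 (hom_mul R))
    (proj1 (hom_one R)) (mul_assoc R) (mul_onel R) (mul_oner R).

End Centre.

#[global] Hint Resolve hom_hb : homs.

Record central_pair (C : strict_monoidal) (A : algebra C) := CentralPair {
  cob : Ob (centre C);
  cmap : Mor C;
  hom_cmap : Hom (hob cob) (aob A) cmap;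
  cmap_central :
    mul A ∘ (cmap ▷ aob A) = mul A ∘ (aob A ◁ cmap) ∘ hb cob (aob A)
}.

Definition central_pairs (C : strict_monoidal) (A : algebra C) : category.
Proof.
refine (@Category (central_pair A) (Mor C)
  (fun P Q f => Hom (cob P) (cob Q) (f : Mor (centre C)) /\ cmap Q ∘ f = cmap P)
  (fun P => idm (hob (cob P))) (@comp C) _ _ _ _ _).
- move=> P; split; first exact: (hom_id (cob P)).
  exact: comp_idr (hom_cmap P).
- move=> P Q R f g [Hf Ef] [Hg Eg]; split; first exact: hom_comp Hf Hg.
  by rewrite (comp_assoc (proj1 Hf) (proj1 Hg) (hom_cmap R)) Eg.
- by move=> P Q f [[Hf _] _]; apply: comp_idl Hf.
- by move=> P Q f [[Hf _] _]; apply: comp_idr Hf.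
- move=> P Q R S f g h [[Hf _] _] [[Hg _] _] [[Hh _] _].
  exact: comp_assoc Hf Hg Hh.
Defined.

Record full_centre (C : strict_monoidal) (A : algebra C) := FullCentre {
  fc_pair :> central_pair A;
  fc_terminal : is_terminal (K := central_pairs A) fc_pair
}.

Definition is_full_centre_algebra (C : strict_monoidal) (A : algebra C)
    (Z : full_centre A) (R : algebra (centre C)) : Prop :=
  aob R = cob Z /\ alg_hom (underlying_algebra R) A (cmap Z).

Section FullCentreAlgebra.
Variables (C : strict_monoidal) (A : algebra C).

Hint Resolve hom_cmap : homs.

Definition central_pair_unit : central_pair A.
Proof.
exists (centre_unit C) (one A); first exact: hom_one.
rewrite mul_onel mul_oner; symmetry; exact: comp_idl (hom_id _).
Defined.

Definition central_pair_tens (P Q : central_pair A) : central_pair A.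
Proof.
exists (centre_tens (cob P) (cob Q)) (mul A ∘ (cmap P ⊠ cmap Q)).
  by typ.
have HP := hom_cmap P; have HQ := hom_cmap Q; have Hm := hom_mul A.
have HI := hom_id (aob A).
have E (f g h : Mor C) X Y Z :
    Hom X (aob A) f -> Hom Y (aob A) g -> Hom Z (aob A) h ->
    mul A ∘ ((mul A ∘ (f ⊠ g)) ⊠ h) = mul A ∘ (f ⊠ (mul A ∘ (g ⊠ h))).
  move=> Hf Hg Hh.
  have -> : (mul A ∘ (f ⊠ g)) ⊠ h = (mul A ▷ aob A) ∘ (f ⊠ g ⊠ h).
    by erewrite tensmC; try sides; rewrite (comp_idl Hh).
  have -> : f ⊠ (mul A ∘ (g ⊠ h)) = (aob A ◁ mul A) ∘ (f ⊠ g ⊠ h).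
    by rewrite -tensmA; erewrite tensmC; try sides; rewrite (comp_idl Hf).
  pull (mul A) (mul A ▷ aob A); rewrite mul_assoc.
  by assr.
have F1 : mul A ∘ ((mul A ∘ (cmap P ⊠ cmap Q)) ▷ aob A)
        = mul A ∘ ((mul A ∘ (cmap P ▷ aob A)) ⊠ cmap Q)
            ∘ (hob (cob P) ◁ hb (cob Q) (aob A)).
  rewrite (E _ _ _ _ _ _ HP HQ HI) (E _ _ _ _ _ _ HP HI HQ) cmap_central.
  assr; erewrite tensmC; try sides.
  by rewrite (comp_idr HP); assr.
have F2 : mul A ∘ ((mul A ∘ (cmap P ▷ aob A)) ⊠ cmap Q)
        = mul A ∘ (aob A ◁ (mul A ∘ (cmap P ⊠ cmap Q)))
            ∘ (hb (cob P) (aob A) ▷ hob (cob Q)).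
  rewrite -(E _ _ _ _ _ _ HI HP HQ) cmap_central.
  assr; erewrite tensmC; try sides.
  by rewrite (comp_idr HQ); assr.
by rewrite F1 F2 /=; assr.
Defined.

Variable T : full_centre A.

Lemma central_hom_unique (P : central_pair A) f g :
  Hom (cob P) (cob T) f -> cmap T ∘ f = cmap P ->
  Hom (cob P) (cob T) g -> cmap T ∘ g = cmap P -> f = g.
Proof.
move=> Hf Ef Hg Eg; have [h [_ Uh]] := fc_terminal T P.
by rewrite -(Uh f) // -(Uh g).
Qed.

Fact full_centre_algebra_exists :
  exists! R : algebra (centre C), is_full_centre_algebra T R.
Proof.
have HT := hom_cmap T.
have [m [[Hm Em] Um]] := fc_terminal T (central_pair_tens T T).
have [u [[Hu Eu] Uu]] := fc_terminal T central_pair_unit.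
rewrite /= in Em Eu.
have HI : Hom (cob T) (cob T) (idm (cob T)) := hom_id _.
have Hm0 : Hom (hob (cob T) ⊗ hob (cob T)) (hob (cob T)) m := proj1 Hm.
have Hu0 : Hom I_ (hob (cob T)) u := proj1 Hu.
have HmA := hom_mul A.
have ET : cmap T ∘ idm (hob (cob T)) = cmap T := comp_idr HT.
pose Z : Ob (centre C) := cob T.
have assoc : m ∘ (m ▷ Z) = m ∘ (Z ◁ m) :> Mor (centre C).
{ apply: (@central_hom_unique
            (central_pair_tens (central_pair_tens T T) T)).
  - exact: hom_comp (hom_tensm Hm HI) Hm.
  - rewrite /=; pull (cmap T) m; rewrite Em.
    assr; erewrite tensmC; try sides.
    by rewrite ET Em.
  - have := hom_comp (hom_tensm HI Hm) Hm; rewrite tensA; exact.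
  - rewrite /=; pull (cmap T) m; rewrite Em.
    assr; erewrite tensmC; try sides.
    rewrite ET Em.
    have -> : (mul A ∘ (cmap T ⊠ cmap T)) ⊠ cmap T
            = (mul A ▷ aob A) ∘ (cmap T ⊠ cmap T ⊠ cmap T).
      by erewrite tensmC; try sides; rewrite (comp_idl HT).
    have -> : cmap T ⊠ (mul A ∘ (cmap T ⊠ cmap T))
            = (aob A ◁ mul A) ∘ (cmap T ⊠ cmap T ⊠ cmap T).
      by rewrite -tensmA; erewrite tensmC; try sides; rewrite (comp_idl HT).
    pull (mul A) (mul A ▷ aob A); rewrite mul_assoc.
    by assr. }
have unitl : m ∘ (u ▷ Z) = idm Z :> Mor (centre C).
{ apply: (@central_hom_unique T) => //.
  - have := hom_comp (hom_tensm Hu HI) Hm; rewrite tens1l; exact.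
  - rewrite /=; pull (cmap T) m; rewrite Em.
    assr; erewrite tensmC; try sides.
    have e := slider (hom_one A) HT eq_refl; rewrite tensm1l in e.
    rewrite ET Eu -e; pull (mul A) (one A ▷ aob A).
    by rewrite mul_onel (comp_idl HT). }
have unitr : m ∘ (Z ◁ u) = idm Z :> Mor (centre C).
{ apply: (@central_hom_unique T) => //.
  - have := hom_comp (hom_tensm HI Hu) Hm; rewrite tens1r; exact.
  - rewrite /=; pull (cmap T) m; rewrite Em.
    assr; erewrite tensmC; try sides.
    have e := slidel HT (hom_one A) eq_refl; rewrite tensm1r in e.
    rewrite ET Eu -e; pull (mul A) (aob A ◁ one A).
    by rewrite mul_oner (comp_idl HT). }
exists (@Algebra (centre C) Z m u Hm Hu assoc unitl unitr); split.
  by split=> //; split.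
case=> Z' m' u' Hm' Hu' a' l' r' [/= EZ]; subst Z'.
case=> _ /= Em' Eu'.
have Em2 := Um m' (conj Hm' Em'); have Eu2 := Uu u' (conj Hu' Eu'); subst.
by f_equal; apply: proof_irrelevance.
Qed.

(* Z(A) with its unique algebra structure such that Z(A) -> A is a homomorphism *)
Definition full_centre_algebra : algebra (centre C) :=
  proj1_sig (constructive_indefinite_description _ full_centre_algebra_exists).

Fact full_centre_algebraP : is_full_centre_algebra T full_centre_algebra.
Proof.
exact: proj1 (proj2_sig
  (constructive_indefinite_description _ full_centre_algebra_exists)).
Qed.

End FullCentreAlgebra.

Record module_category (C : strict_monoidal) := ModuleCategory {
  modcat :> category;
  act : Ob C -> Ob modcat -> Ob modcat;
  actm : Mor C -> Mor modcat -> Mor modcat;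
  hom_actm : forall X Y M N f g, Hom X Y f -> Hom M N g ->
    Hom (act X M) (act Y N) (actm f g);
  actm_id : forall X M, actm (idm X) (idm M) = idm (act X M);
  actm_comp : forall X Y Z L M N f f' g g',
    Hom X Y f -> Hom Y Z f' -> Hom L M g -> Hom M N g' ->
    actm (f' ∘ f) (g' ∘ g) = actm f' g' ∘ actm f g;
  (* the associativity constraint [(X ⊗ Y) * M -> X * (Y * M)] *)
  massoc : Ob C -> Ob C -> Ob modcat -> Mor modcat;
  massoc_iso : forall X Y M,
    is_iso (act (X ⊗ Y) M) (act X (act Y M)) (massoc X Y M);
  massoc_nat : forall X X' Y Y' M M' f g h,
    Hom X X' f -> Hom Y Y' g -> Hom M M' h ->
    massoc X' Y' M' ∘ actm (f ⊠ g) h = actm f (actm g h) ∘ massoc X Y M;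
  (* the unit constraint [I * M -> M] *)
  munit : Ob modcat -> Mor modcat;
  munit_iso : forall M, is_iso (act I_ M) M (munit M);
  munit_nat : forall M M' h, Hom M M' h ->
    munit M' ∘ actm (idm I_) h = h ∘ munit M;
  massoc_pentagon : forall X Y Z M,
    actm (idm X) (massoc Y Z M) ∘ massoc X (Y ⊗ Z) M =
    massoc X Y (act Z M) ∘ massoc (X ⊗ Y) Z M;
  munit_triangle : forall X M,
    actm (idm X) (munit M) ∘ massoc X I_ M = idm (act X M)
}.
Arguments act {C m}.
Arguments actm {C m}.
Arguments massoc {C m}.
Arguments munit {C m}.

Record module_functor (C : strict_monoidal) (M N : module_category C) :=
  ModuleFunctor {
  mfun :> functor M N;
  (* the structure isomorphism [F (X * P) -> X * F P] *)
  mstr : Ob C -> Ob M -> Mor N;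
  mstr_iso : forall X P,
    is_iso (fob mfun (act X P)) (act X (fob mfun P)) (mstr X P);
  mstr_nat : forall X Y P Q f g, Hom X Y f -> Hom P Q g ->
    mstr Y Q ∘ fmor mfun (act X P) (act Y Q) (actm f g) =
    actm f (fmor mfun P Q g) ∘ mstr X P;
  mstr_assoc : forall X Y P,
    massoc X Y (fob mfun P) ∘ mstr (X ⊗ Y) P =
    actm (idm X) (mstr Y P) ∘ mstr X (act Y P)
      ∘ fmor mfun (act (X ⊗ Y) P) (act X (act Y P)) (massoc X Y P);
  mstr_unit : forall P,
    munit (fob mfun P) ∘ mstr I_ P = fmor mfun (act I_ P) P (munit P)
}.

(* Only F is required to carry a module structure: one on its quasi-inverse can
   then be derived. *)
Definition module_equivalent (C : strict_monoidal) (M N : module_category C) :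
  Prop := exists F : module_functor M N, is_equivalence F.

Record rmodule (C : strict_monoidal) (A : algebra C) := RModule {
  rob : Ob C;
  ract : Mor C;
  hom_ract : Hom (rob ⊗ aob A) rob ract;
  ract_mul : ract ∘ (ract ▷ aob A) = ract ∘ (rob ◁ mul A);
  ract_one : ract ∘ (rob ◁ one A) = idm rob
}.

Section RightModules.
Variables (C : strict_monoidal) (A : algebra C).

Definition rmodule_hom (M N : rmodule A) (f : Mor C) : Prop :=
  Hom (rob M) (rob N) f /\ f ∘ ract M = ract N ∘ (f ▷ aob A).

Hint Resolve hom_ract : homs.

Definition rmodule_cat : category.
Proof.
refine (@Category (rmodule A) (Mor C) rmodule_hom (fun M => idm (rob M))
          (@comp C) _ _ _ _ _).
- move=> M; split; first exact: hom_id.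
  rewrite tensm_id (comp_idl (hom_ract M)); symmetry.
  exact: comp_idr (hom_ract M).
- move=> L M N f g [Hf Ef] [Hg Eg]; split; first exact: hom_comp Hg.
  whisk; assr; rewrite Ef; pull g (ract M); rewrite Eg.
  by assr.
- by move=> M N f [Hf _]; apply: comp_idl Hf.
- by move=> M N f [Hf _]; apply: comp_idr Hf.
- move=> K L M N f g h [Hf _] [Hg _] [Hh _].
  exact: comp_assoc Hf Hg Hh.
Defined.

Definition rmodule_act (X : Ob C) (M : rmodule A) : rmodule A.
Proof.
exists (X ⊗ rob M) (X ◁ ract M).
- by typ.
- rewrite -tensmA; erewrite <- !whl_comp; try sides.
  rewrite ract_mul -tensm_id -tensmA.
  by erewrite <- whl_comp; try sides.
- rewrite -tensm_id -tensmA; erewrite <- whl_comp; try sides.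
  by rewrite ract_one.
Defined.

Lemma rmodule_eq_iso (M N : rmodule A) :
  rob M = rob N -> ract M = ract N ->
  is_iso (K := rmodule_cat) M N (idm (rob M)).
Proof.
have H (K L : rmodule A) : rob K = rob L -> ract K = ract L ->
    rmodule_hom K L (idm (rob K)).
  move=> e e'; split; first by rewrite e; apply: hom_id.
  rewrite tensm_id (comp_idl (hom_ract K)) -e'; symmetry.
  exact: comp_idr (hom_ract K).
move=> e e'; exists (idm (rob N)); split=> /=; try by apply: H.
- by rewrite e; apply: comp_idl (hom_id _).
- by rewrite e; apply: comp_idl (hom_id _).
Qed.

Definition rmodules : module_category C.
Proof.
refine (@ModuleCategory C rmodule_cat rmodule_act (@tensm C) _ _ _
  (fun X Y M => idm (X ⊗ Y ⊗ rob M)) _ _ (fun M => idm (rob M)) _ _ _ _).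
- move=> X Y M N f g Hf [Hg Eg]; split=> /=; first exact: hom_tensm.
  erewrite tensmC; try sides.
  rewrite -tensmA; erewrite tensmC; try sides.
  by rewrite Eg (comp_idl Hf) (comp_idr Hf).
- by move=> X M; apply: tensm_id.
- move=> X Y Z L M N f f' g g' Hf Hf' [Hg _] [Hg' _].
  exact: tensm_comp Hf Hf' Hg Hg'.
- move=> X Y M; apply: rmodule_eq_iso => /=; first by rewrite tensA.
  by rewrite -tensm_id tensmA.
- move=> X X' Y Y' M M' f g h Hf Hg [Hh _] /=.
  rewrite tensmA; erewrite comp1l; try sides.
  by erewrite comp1r; try sides.
- move=> M; have -> : rob M = rob (rmodule_act I_ M) by rewrite /= tens1l.
  by apply: rmodule_eq_iso => /=; rewrite ?tens1l ?tensm1l.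
- move=> M M' h [Hh _] /=.
  by rewrite tensm1l (comp_idl Hh) (comp_idr Hh).
- move=> X Y Z M /=.
  by rewrite tensm_id !tensA.
- move=> X M /=.
  by rewrite tensm_id tens1r (comp_idl (hom_id _)).
Defined.

End RightModules.

Definition morita_equivalent (C : strict_monoidal) (A B : algebra C) : Prop :=
  module_equivalent (rmodules A) (rmodules B).

(* Main.v *)
From Stdlib Require Import ssreflect ssrfun ssrbool IndefiniteDescription.
Require Import Defs.

(* For a C-module category M, consider the pairs of an object Z of the monoidal
  centre and a morphism [Z * - -> Id] of C-module endofunctors of M.  For
  M = C_A such morphisms correspond to the central maps [Z -> A]: a central map c
  acts on a module M through [Z ⊗ M -> M ⊗ Z -> M ⊗ A -> M], and c is recovered
  on the unit of the regular module.  These pairs depend only on the C-module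
  category, so an equivalence [C_A -> C_B] matches central maps to A with central
  maps to B out of the same Z, bijectively and compatibly with precomposition,
  products and units.  Hence Z(A), with its own algebra structure, is also a full
  centre of B, and full centres are unique up to an isomorphism of algebras. *)

Set Implicit Arguments.
Unset Strict Implicit.
Unset Printing Implicit Defensive.

Arguments comp_assoc {c W X Y Z f g h}.

(* Counterparts of [synth], [assr] and [pull] for an arbitrary category. *)
Ltac khom :=
  lazymatch goal with
  | |- Hom _ _ (idm _) => apply: hom_id
  | |- Hom _ _ (_ ∘ _) => eapply hom_comp; [khom | khom]
  | |- Hom _ _ (actm _ _) => eapply hom_actm; khom
  | |- Hom _ _ (fmor _ _ _ _) => eapply hom_fmor; khom
  | |- Hom _ _ _ => first [ eassumption | solve [eauto 2 with homs] ]
  end.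

Ltac kassr :=
  repeat match goal with
  | |- context [?h ∘ ?g ∘ ?f] =>
    let E := fresh in
    assert (E : h ∘ g ∘ f = h ∘ (g ∘ f))
      by (symmetry; eapply comp_assoc; khom);
    rewrite E; clear E
  end.

Ltac kpull h g :=
  match goal with
  | |- context [h ∘ (g ∘ ?f)] =>
    let E := fresh in
    assert (E : h ∘ (g ∘ f) = (h ∘ g) ∘ f) by (eapply comp_assoc; khom);
    rewrite E; clear E
  end.

(** * Isomorphisms, and full faithfulness of equivalences *)

Section Categories.
Variable K : category.

Lemma iso_hom (X Y : Ob K) e : is_iso X Y e -> Hom X Y e.
Proof. by case=> g []. Qed.

Lemma iso_epi (X Y Z : Ob K) e f g : is_iso X Y e ->
  Hom Y Z f -> Hom Y Z g -> f ∘ e = g ∘ e -> f = g.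
Proof.
move=> [d [He Hd _ ed]] Hf Hg /(congr1 (fun k => k ∘ d)); kassr.
by rewrite ed (comp_idr Hf) (comp_idr Hg).
Qed.

Lemma iso_mono (X Y Z : Ob K) e f g : is_iso Y Z e ->
  Hom X Y f -> Hom X Y g -> e ∘ f = e ∘ g -> f = g.
Proof.
move=> [d [He Hd de _]] Hf Hg /(congr1 (fun k => d ∘ k)).
rewrite (comp_assoc Hf He Hd) (comp_assoc Hg He Hd).
by rewrite de (comp_idl Hf) (comp_idl Hg).
Qed.

Lemma iso_extend (X Y Z : Ob K) e f : is_iso X Y e -> Hom X Z f ->
  exists g, Hom Y Z g /\ g ∘ e = f.
Proof.
move=> [d [He Hd de _]] Hf; exists (f ∘ d); split; first by khom.
by kassr; rewrite de (comp_idr Hf).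
Qed.

End Categories.

(** Naturality of [t] recovers an arrow from its image under G F, because the components of [t] can
    be cancelled. *)
Lemma faithful_of_retraction (K L : category) (F : functor K L)
    (G : functor L K) : nat_iso (functor_comp G F) (functor_id K) ->
  forall X Y f g, Hom X Y f -> Hom X Y g -> fmor F X Y f = fmor F X Y g ->
  f = g.
Proof.
move=> [t [it nt]] X Y f g Hf Hg E.
by apply: (iso_epi (it X) Hf Hg); rewrite -(nt _ _ _ Hf) -(nt _ _ _ Hg) /= E.
Qed.

Section Equivalences.
Variables (K L : category) (F : functor K L).
Hypothesis eqF : is_equivalence F.

Lemma equivalence_faithful X Y f g : Hom X Y f -> Hom X Y g ->
  fmor F X Y f = fmor F X Y g -> f = g.
Proof. by case: eqF => G [? _]; apply: faithful_of_retraction; eassumption. Qed.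

Lemma equivalence_full X Y h : Hom (fob F X) (fob F Y) h ->
  exists f, Hom X Y f /\ fmor F X Y f = h.
Proof.
case: eqF => G [GF FG] Hh; have [t [it nt]] := GF.
have HG := hom_fmor G Hh.
(* [f] is the conjugate of G h by [t], which forces G F f = G h; G is faithful because of the other
   isomorphism. *)
have [f [Hf Ef]] := iso_extend (it X) (hom_comp HG (iso_hom (it Y))).
exists f; split=> //.
apply: (faithful_of_retraction FG (hom_fmor F Hf) Hh).
apply: (iso_mono (it Y) (hom_fmor G (hom_fmor F Hf)) HG).
by have /= -> := nt _ _ _ Hf.
Qed.

End Equivalences.

(** * Central actions on a module category *)

Section CentralActions.
Variable C : strict_monoidal.

Lemma hom_massoc (M : module_category C) X Y (P : Ob M) :
  Hom (act (X ⊗ Y) P) (act X (act Y P)) (massoc X Y P).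
Proof. exact: iso_hom (massoc_iso _ _ _). Qed.

Lemma hom_munit (M : module_category C) (P : Ob M) :
  Hom (act I_ P) P (munit P).
Proof. exact: iso_hom (munit_iso _). Qed.

Lemma hom_mstr (M N : module_category C) (F : module_functor M N) X P :
  Hom (fob F (act X P)) (act X (fob F P)) (mstr F X P).
Proof. exact: iso_hom (mstr_iso _ _ _). Qed.

Hint Resolve hom_massoc hom_munit hom_mstr : homs.

Lemma actm_iso (M : module_category C) X (P Q : Ob M) e :
  is_iso P Q e -> is_iso (act X P) (act X Q) (actm (idm X) e).
Proof.
move=> [d [He Hd de ed]]; exists (actm (idm X) d).
have Hi := hom_id X.
split; try khom.
- by rewrite -(actm_comp Hi Hi He Hd) (comp_idl Hi) de actm_id.
- by rewrite -(actm_comp Hi Hi Hd He) (comp_idl Hi) ed actm_id.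
Qed.

Lemma actm_compr (M : module_category C) X (P Q R : Ob M) f g :
  Hom P Q f -> Hom Q R g ->
  actm (idm X) (g ∘ f) = actm (idm X) g ∘ actm (idm X) f.
Proof.
move=> Hf Hg; have Hi := hom_id X.
by rewrite -(actm_comp Hi Hi Hf Hg) (comp_idl Hi).
Qed.

Lemma actm_exchange (M : module_category C) X Y (P Q : Ob M) f g :
  Hom X Y f -> Hom P Q g ->
  actm (idm Y) g ∘ actm f (idm P) = actm f (idm Q) ∘ actm (idm X) g.
Proof.
move=> Hf Hg.
rewrite -(actm_comp Hf (hom_id Y) (hom_id P) Hg).
rewrite -(actm_comp (hom_id X) Hf Hg (hom_id Q)).
by rewrite (comp_idl Hf) (comp_idr Hf) (comp_idl Hg) (comp_idr Hg).
Qed.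

Section OneCategory.
Variable M : module_category C.

(** Module naturality of [t], precomposed with [massoc] so that no inverse constraint occurs. It is
    isolated at one X and P because transport along a functor establishes it object by object. *)
Definition compatible_at (Z : half_braided C) (t : Ob M -> Mor M) X P :=
  t (act X P) ∘ massoc (hob Z) X P =
  actm (idm X) (t P) ∘ massoc X (hob Z) P ∘ actm (hb Z X) (idm P).

(* A morphism [Z * - -> Id] of C-module endofunctors of M, the half-braiding of
  Z making [Z * -] a C-module functor. *)
Definition central_action (Z : half_braided C) (t : Ob M -> Mor M) : Prop :=
  [/\ forall P, Hom (act (hob Z) P) P (t P),
      forall P Q f, Hom P Q f -> t Q ∘ actm (idm (hob Z)) f = f ∘ t P
    & forall X P, compatible_at Z t X P].

Definition action_restrict (f : Mor C) (t : Ob M -> Mor M) P :=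
  t P ∘ actm f (idm P).

Definition action_tens (Z W : half_braided C) (t u : Ob M -> Mor M) P :=
  t P ∘ actm (idm (hob Z)) (u P) ∘ massoc (hob Z) (hob W) P.

(** Both sides are natural in P, and the arrow induced by [e] can be cancelled. This serves to pass
    from the image of an equivalence to all objects. *)
Lemma compatible_iso (Z : half_braided C) (t : Ob M -> Mor M) X P Q e :
  (forall P, Hom (act (hob Z) P) P (t P)) ->
  (forall P Q f, Hom P Q f -> t Q ∘ actm (idm (hob Z)) f = f ∘ t P) ->
  is_iso P Q e -> compatible_at Z t X P -> compatible_at Z t X Q.
Proof.
move=> Ht nt ie; have He := iso_hom ie; rewrite /compatible_at => cP.
have Hz := hom_hb Z X; have Hi := hom_id X; have HZ := hom_id (hob Z).
apply: (iso_epi (actm_iso (hob Z ⊗ X) ie)); try khom.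
have HXe := hom_actm Hi He.
have EL := massoc_nat HZ Hi He; rewrite tensm_id in EL.
have ER := massoc_nat Hi HZ He; rewrite tensm_id in ER.
kassr; rewrite EL.
kpull (t (act X Q)) (actm (idm (hob Z)) (actm (idm X) e)).
rewrite (nt _ _ _ HXe); kassr; rewrite cP.
rewrite -(actm_exchange Hz He).
kpull (massoc X (hob Z) Q) (actm (idm (X ⊗ hob Z)) e); rewrite ER; kassr.
kpull (actm (idm X) (t Q)) (actm (idm X) (actm (idm (hob Z)) e)).
rewrite -(actm_compr _ (hom_actm HZ He) (Ht Q)) (nt _ _ _ He).
by rewrite (actm_compr _ (Ht P) He); kassr.
Qed.

End OneCategory.

(** * Transport of actions along a module functor *)

Section Transport.
Variables (M N : module_category C) (F : module_functor M N).

(** A relation and not a function of [t]: it constrains [u] only at objects F P, and naturality has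
    to fix the other values. *)
Definition intertwined X (t : Ob M -> Mor M) (u : Ob N -> Mor N) : Prop :=
  forall P, fmor F (act X P) P (t P) = u (fob F P) ∘ mstr F X P.

Lemma intertwined_restrict X Y f t u :
  (forall P, Hom (act Y P) P (t P)) -> (forall P, Hom (act Y P) P (u P)) ->
  Hom X Y f -> intertwined Y t u ->
  intertwined X (action_restrict f t) (action_restrict f u).
Proof.
move=> Ht Hu Hf E P; rewrite /action_restrict.
have Hi := hom_id P.
rewrite (fmor_comp _ (hom_actm Hf Hi) (Ht P)) E; kassr.
by rewrite (mstr_nat F Hf Hi) fmor_id; kassr.
Qed.

Lemma intertwined_tens (Z W : half_braided C) t t' u u' :
  (forall P, Hom (act (hob Z) P) P (t P)) ->
  (forall P, Hom (act (hob W) P) P (t' P)) ->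
  (forall P, Hom (act (hob Z) P) P (u P)) ->
  (forall P, Hom (act (hob W) P) P (u' P)) ->
  intertwined (hob Z) t u -> intertwined (hob W) t' u' ->
  intertwined (hob Z ⊗ hob W) (action_tens Z W t t') (action_tens Z W u u').
Proof.
move=> Ht Ht' Hu Hu' E E' P; rewrite /action_tens.
have HZ := hom_id (hob Z).
have Ha := hom_massoc (hob Z) (hob W) P.
have Hzt := hom_actm HZ (Ht' P).
rewrite (fmor_comp _ Ha (hom_comp Hzt (Ht P))) (fmor_comp _ Hzt (Ht P)) E.
kassr.
rewrite mstr_assoc.
kpull (mstr F (hob Z) P)
  (fmor F (act (hob Z) (act (hob W) P)) (act (hob Z) P)
     (actm (idm (hob Z)) (t' P))).
rewrite (mstr_nat F HZ (Ht' P)) E'.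
by rewrite (actm_compr _ (hom_mstr F (hob W) P) (Hu' _)); kassr.
Qed.

Lemma intertwined_unit : intertwined I_ munit munit.
Proof. by move=> P; rewrite mstr_unit. Qed.

Section Compatibility.
Variables (Z : half_braided C) (t : Ob M -> Mor M) (u : Ob N -> Mor N).
Hypothesis Ht : forall P, Hom (act (hob Z) P) P (t P).
Hypothesis Hu : forall P, Hom (act (hob Z) P) P (u P).
Hypothesis nu :
  forall P Q f, Hom P Q f -> u Q ∘ actm (idm (hob Z)) f = f ∘ u P.
Hypothesis E : intertwined (hob Z) t u.

(** Together with [mstr_compatible_right], this carries both sides of the compatibility condition
    through F. Hence the condition passes between [t] at P and [u] at F P: both directions cancel
    [mstr], and the one back to [t] also uses faithfulness. *)
Lemma mstr_compatible_left X P :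
  mstr F X P ∘ fmor F (act (hob Z ⊗ X) P) (act X P)
      (t (act X P) ∘ massoc (hob Z) X P) =
  u (act X (fob F P)) ∘ massoc (hob Z) X (fob F P) ∘ mstr F (hob Z ⊗ X) P.
Proof.
have Ha := hom_massoc (hob Z) X P.
rewrite (fmor_comp _ Ha (Ht _)) E; kassr; rewrite mstr_assoc; kassr.
kpull (u (act X (fob F P))) (actm (idm (hob Z)) (mstr F X P)).
by rewrite (nu (hom_mstr F X P)); kassr.
Qed.

Lemma mstr_compatible_right X P :
  mstr F X P ∘ fmor F (act (hob Z ⊗ X) P) (act X P)
      (actm (idm X) (t P) ∘ massoc X (hob Z) P ∘ actm (hb Z X) (idm P)) =
  actm (idm X) (u (fob F P)) ∘ massoc X (hob Z) (fob F P)
    ∘ actm (hb Z X) (idm (fob F P)) ∘ mstr F (hob Z ⊗ X) P.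
Proof.
have Ha := hom_massoc X (hob Z) P; have Hi := hom_id X.
have Hz := hom_hb Z X; have HP := hom_id P.
have Hxt := hom_actm Hi (Ht P).
rewrite (fmor_comp _ (hom_actm Hz HP) (hom_comp Ha Hxt)).
rewrite (fmor_comp _ Ha Hxt); kassr.
kpull (mstr F X P)
  (fmor F (act X (act (hob Z) P)) (act X P) (actm (idm X) (t P))).
rewrite (mstr_nat F Hi (Ht P)) E.
rewrite (actm_compr _ (hom_mstr F (hob Z) P) (Hu _)); kassr.
rewrite -(fmor_id F P) -(mstr_nat F Hz HP).
kpull (massoc X (hob Z) (fob F P)) (mstr F (X ⊗ hob Z) P).
by rewrite mstr_assoc; kassr.
Qed.

Lemma compatible_push X P :
  compatible_at Z t X P -> compatible_at Z u X (fob F P).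
Proof.
move=> c; have Hz := hom_hb Z X.
apply: (iso_epi (mstr_iso F _ _)); try khom.
by rewrite -mstr_compatible_left c mstr_compatible_right.
Qed.

Lemma compatible_pull X P : is_equivalence F ->
  compatible_at Z u X (fob F P) -> compatible_at Z t X P.
Proof.
move=> eqF c; have Hz := hom_hb Z X.
apply: (equivalence_faithful eqF); try khom.
apply: (iso_mono (mstr_iso F _ _)); try khom.
by rewrite mstr_compatible_left c -mstr_compatible_right.
Qed.

End Compatibility.

Hypothesis eqF : is_equivalence F.

Lemma intertwined_injl X t t' u :
  (forall P, Hom (act X P) P (t P)) -> (forall P, Hom (act X P) P (t' P)) ->
  intertwined X t u -> intertwined X t' u -> forall P, t P = t' P.
Proof.
move=> Ht Ht' E E' P; apply: (equivalence_faithful eqF (Ht P) (Ht' P)).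
by rewrite E E'.
Qed.

(** Naturality along F G Q -> Q reduces equality at Q to equality at F G Q, where the intertwining
    relation prescribes the value. *)
Lemma intertwined_injr Z t u u' :
  central_action Z u -> central_action Z u' ->
  intertwined (hob Z) t u -> intertwined (hob Z) t u' -> forall Q, u Q = u' Q.
Proof.
move=> [Hu nu _] [Hu' nu' _] E E' Q.
have [G [_ [e [ie _]]]] := eqF; have iQ := ie Q.
apply: (iso_epi (actm_iso (hob Z) iQ) (Hu Q) (Hu' Q)).
rewrite (nu _ _ _ (iso_hom iQ)) (nu' _ _ _ (iso_hom iQ)); congr comp.
apply: (iso_epi (mstr_iso F _ _) (Hu _) (Hu' _)).
by rewrite -E -E'.
Qed.

(** Fullness supplies each component of [t]; faithfulness reflects naturality and compatibility from
    [u]. *)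
Lemma central_action_pull Z u : central_action Z u ->
  exists t, central_action Z t /\ intertwined (hob Z) t u.
Proof.
move=> [Hu nu cu].
have ex P : exists f, Hom (act (hob Z) P) P f /\
    fmor F (act (hob Z) P) P f = u (fob F P) ∘ mstr F (hob Z) P.
  by apply: (equivalence_full eqF); khom.
have [t Et] := functional_choice _ ex.
have Ht P := proj1 (Et P); have E P := proj2 (Et P).
exists t; split=> //; split=> // [P Q f Hf | X P].
- have HZ := hom_id (hob Z); apply: (equivalence_faithful eqF); try khom.
  rewrite (fmor_comp F (hom_actm HZ Hf) (Ht Q)) (fmor_comp F (Ht P) Hf) !E.
  have HFf := hom_fmor F Hf.
  kassr; rewrite (mstr_nat F HZ Hf).
  kpull (u (fob F Q)) (actm (idm (hob Z)) (fmor F P Q f)).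
  by rewrite (nu _ _ _ HFf); kassr.
- exact: (compatible_pull Ht Hu nu E eqF (cu X (fob F P))).
Qed.

(** Naturality along [e] : F G Q -> Q leaves one candidate for [u] at Q: the image under F of [t] at
    G Q, conjugated by [e] and [mstr]. *)
Lemma central_action_push Z t : central_action Z t ->
  exists u, central_action Z u /\ intertwined (hob Z) t u.
Proof.
move=> [Ht nt ct].
have [G [_ [e [ie ne]]]] := eqF.
have He Q : Hom (fob F (fob G Q)) Q (e Q) := iso_hom (ie Q).
have HZ := hom_id (hob Z).
pose p Q := actm (idm (hob Z)) (e Q) ∘ mstr F (hob Z) (fob G Q).
have ip Q : is_iso (fob F (act (hob Z) (fob G Q))) (act (hob Z) Q) (p Q).
  apply: is_iso_comp (mstr_iso F _ _) _.
  exact: actm_iso (ie Q).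
have ex Q : exists f, Hom (act (hob Z) Q) Q f /\
    f ∘ p Q = e Q ∘ fmor F (act (hob Z) (fob G Q)) (fob G Q) (t (fob G Q)).
  by apply: (iso_extend (ip Q)); khom.
have [u Eu] := functional_choice _ ex.
have Hu Q := proj1 (Eu Q).
have Ep Q : u Q ∘ (actm (idm (hob Z)) (e Q) ∘ mstr F (hob Z) (fob G Q)) =
    e Q ∘ fmor F (act (hob Z) (fob G Q)) (fob G Q) (t (fob G Q)).
  exact: proj2 (Eu Q).
have nF P Q f : Hom P Q f ->
    fmor F (act (hob Z) Q) Q (t Q)
      ∘ fmor F (act (hob Z) P) (act (hob Z) Q) (actm (idm (hob Z)) f) =
    fmor F P Q f ∘ fmor F (act (hob Z) P) P (t P).
  move=> Hf; rewrite -(fmor_comp F (hom_actm HZ Hf) (Ht Q)) (nt _ _ _ Hf).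
  by rewrite (fmor_comp F (Ht P) Hf).
have nu P Q f : Hom P Q f -> u Q ∘ actm (idm (hob Z)) f = f ∘ u P.
  move=> Hf; have HGf := hom_fmor G Hf; have HFGf := hom_fmor F HGf.
  apply: (iso_epi (ip P)); try khom.
  rewrite /p; kassr.
  rewrite Ep; kpull (actm (idm (hob Z)) f) (actm (idm (hob Z)) (e P)).
  have /= nf := ne _ _ _ Hf.
  rewrite -(actm_compr _ (He P) Hf) -nf (actm_compr _ HFGf (He Q)); kassr.
  rewrite -(mstr_nat F HZ HGf).
  kpull (actm (idm (hob Z)) (e Q)) (mstr F (hob Z) (fob G Q)).
  kpull (u Q) (actm (idm (hob Z)) (e Q) ∘ mstr F (hob Z) (fob G Q)).
  rewrite Ep; kassr; rewrite (nF _ _ _ HGf).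
  kpull (e Q) (fmor F (fob G P) (fob G Q) (fmor G P Q f)).
  by rewrite nf; kassr.
have E : intertwined (hob Z) t u.
  (* [u] at F P was built from [t] at G F P, not at P. Fullness lifts [e] at F P to [k] : G F P ->
     P, and naturality of [t] along [k] compares the two; [v] is the value that the relation demands
     at F P. *)
  move=> P; have [k [Hk Ek]] := equivalence_full eqF (He (fob F P)).
  have HFt := hom_fmor F (Ht P).
  have [v [Hv Ev]] := iso_extend (mstr_iso F (hob Z) P) HFt.
  rewrite -Ev; congr comp; apply: (iso_epi (ip (fob F P)) Hv (Hu _)).
  rewrite {2}/p Ep -Ek -(nF _ _ _ Hk) /p -Ek -(mstr_nat F HZ Hk).
  have HFZk := hom_fmor F (hom_actm HZ Hk).
  by kpull v (mstr F (hob Z) P); rewrite Ev.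
exists u; split=> //; split=> // X Q.
(* Compatibility is pushed from G Q to F G Q, and [e] carries it on to Q. *)
apply: (compatible_iso Hu nu (ie Q)).
exact: (compatible_push Ht Hu nu E (ct X (fob G Q))).
Qed.

End Transport.

End CentralActions.

(** * Central actions on right modules are central maps *)

Section ModulesOverAnAlgebra.
Variables (C : strict_monoidal) (A : algebra C).

Hint Resolve hom_ract hom_cmap : homs.

Definition pair_action (P : central_pair A) (M : rmodule A) : Mor C :=
  ract M ∘ (rob M ◁ cmap P ∘ hb (cob P) (rob M)).

Lemma hom_pair_action (P : central_pair A) (M : rmodule A) :
  Hom (hob (cob P) ⊗ rob M) (rob M) (pair_action P M).
Proof. by rewrite /pair_action; typ. Qed.

Hint Resolve hom_pair_action : homs.

(** Centrality of [cmap] enters here: [hb_tens] splits the passage of Z across M ⊗ A, and centrality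
    removes the part across A. The identity makes the action a map of right modules. *)
Lemma pair_action_ract (P : central_pair A) (M : rmodule A) :
  pair_action P M ∘ (hob (cob P) ◁ ract M) = ract M ∘ (pair_action P M ▷ aob A).
Proof.
have Hz := hom_hb (cob P); have Hc := hom_cmap P; have Hn := hom_ract M.
rewrite /pair_action; whisk; assr.
rewrite (hb_nat (cob P) Hn).
pull (rob M ◁ cmap P) (ract M ▷ hob (cob P)).
erewrite slidel; try sides.
erewrite <- slider; try sides.
assr; pull (ract M) (ract M ▷ aob A); rewrite ract_mul hb_tens.
rewrite -(tensm_id (rob M)) -tensmA.
assr; pull (rob M ◁ aob A ◁ cmap P) (rob M ◁ hb (cob P) (aob A)).
pull (rob M ◁ mul A) (rob M ◁ aob A ◁ cmap P ∘ rob M ◁ hb (cob P) (aob A)).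
have -> : rob M ◁ mul A ∘ (rob M ◁ aob A ◁ cmap P ∘ rob M ◁ hb (cob P) (aob A))
  = rob M ◁ mul A ∘ rob M ◁ cmap P ▷ aob A.
  transitivity (rob M ◁ (mul A ∘ (aob A ◁ cmap P) ∘ hb (cob P) (aob A))).
    by whisk; assr.
  by rewrite -cmap_central; whisk.
assr.
pull (ract M) (rob M ◁ mul A); rewrite -ract_mul; assr.
by rewrite tensmA.
Qed.

Lemma pair_action_central (P : central_pair A) :
  central_action (M := rmodules A) (cob P) (pair_action P).
Proof.
split=> [M | M N f [Hf Ef] | X M] /=.
- split=> /=; first exact: hom_pair_action.
  exact: pair_action_ract.
- rewrite /pair_action; assr; rewrite (hb_nat (cob P) Hf).
  pull (rob N ◁ cmap P) (f ▷ hob (cob P)).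
  erewrite slidel; try sides.
  erewrite <- slider; try sides.
  by assr; pull f (ract M); rewrite Ef; assr.
- rewrite /compatible_at /=.
  have Hp := hom_pair_action P (rmodule_act X M); rewrite /= in Hp.
  have Hz := hom_hb (cob P).
  (* Composition of module maps is composition in C; once this is exposed, the associativity
     constraints, which are identity arrows, cancel. *)
  change (@comp (modcat (rmodules A))) with (@comp C).
  rewrite (comp1r Hp (tensA _ _ _)).
  erewrite comp1r; try sides.
  rewrite /pair_action /= hb_tens; whisk; assr.
  by rewrite -(tensm_id X) -tensmA.
Qed.

Lemma pair_action_restrict (P Q : central_pair A) f (M : rmodule A) :
  Hom (c := central_pairs A) P Q f ->
  pair_action P M =
  action_restrict (M := rmodules A) f (pair_action Q) M.
Proof.
move=> [[Hf Ef] /= e]; rewrite /action_restrict /pair_action /= -e.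
by whisk; assr; rewrite Ef.
Qed.

(** The action of P, being a module map, moves past the A-action used by Q; [ract_mul] then merges
    the two A-actions into the multiplication that defines the product pair. *)
Lemma pair_action_tens (P Q : central_pair A) (M : rmodule A) :
  pair_action (central_pair_tens P Q) M =
  action_tens (M := rmodules A) (cob P) (cob Q)
    (pair_action P) (pair_action Q) M.
Proof.
have Hc := hom_cmap P; have Hc' := hom_cmap Q.
rewrite /action_tens /=.
erewrite comp1r; try sides.
rewrite {3}/pair_action; whisk.
pull (pair_action P M) (hob (cob P) ◁ ract M).
rewrite pair_action_ract; rewrite /pair_action /=; whisk; assr.
pull (ract M) (ract M ▷ aob A); rewrite ract_mul; assr.
do 2! congr comp.
rewrite (tensmA _ (idm (rob M))) tensm_id.
pull (hb (cob P) (rob M) ▷ aob A) ((hob (cob P) ⊗ rob M) ◁ cmap Q).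
have Hz := hom_hb (cob P) (rob M).
rewrite (slider Hz Hc' eq_refl) -(slidel Hz Hc' eq_refl).
assr; pull ((rob M ◁ cmap P) ▷ aob A) ((rob M ⊗ hob (cob P)) ◁ cmap Q).
rewrite (slider (hom_tensm (hom_id (rob M)) Hc) Hc' eq_refl).
by rewrite tensmA.
Qed.

Lemma pair_action_unit (M : rmodule A) :
  pair_action (central_pair_unit A) M = munit (m := rmodules A) M.
Proof.
rewrite /pair_action /=.
by erewrite comp1r; try sides; rewrite ract_one.
Qed.

Definition regular_module : rmodule A :=
  RModule (hom_mul A) (mul_assoc A) (mul_oner A).

(** The half-braiding is natural along the unit of A and trivial at [I_], so it disappears, and the
    unit law leaves the central map. *)
Lemma pair_action_one (P : central_pair A) :
  pair_action P regular_module ∘ (hob (cob P) ◁ one A) = cmap P.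
Proof.
rewrite /pair_action /=.
have Ho := hom_one A; have Hc := hom_cmap P; have Hz := hom_hb (cob P) (aob A).
assr; rewrite (hb_nat (cob P) Ho) hb_unit.
erewrite comp1r; try sides.
erewrite slidel; try sides.
have := slider Ho Hc eq_refl; rewrite tensm1l => <-.
by pull (mul A) (one A ▷ aob A); rewrite mul_onel (comp_idl Hc).
Qed.

(* An action is determined by its value on the regular module because the action
  of A on any module M is a module map [M * A -> M] split by the unit. *)
Lemma central_action_pair (Z : half_braided C) (t : rmodule A -> Mor C) :
  central_action (M := rmodules A) Z t ->
  exists P : central_pair A, cob P = Z /\ forall M, t M = pair_action P M.
Proof.
move=> [Ht nt ct].
have [HR ER] := Ht regular_module; rewrite /= in HR ER.
have Ho := hom_one A; have Hm := hom_mul A.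
(* The only possible central map, by [pair_action_one]. *)
pose z : Mor C := t regular_module ∘ (hob Z ◁ one A).
have Hz : Hom (hob Z) (aob A) z by rewrite /z; typ.
have e1 : t regular_module = mul A ∘ (z ▷ aob A).
  rewrite /z; whisk; pull (mul A) (t regular_module ▷ aob A).
  rewrite -ER; assr; rewrite -tensmA.
  erewrite <- whl_comp; try sides.
  by rewrite mul_onel tensm_id; erewrite comp1r; try sides.
have e2 (M : rmodule A) : t M = ract M ∘ (rob M ◁ z ∘ hb Z (rob M)).
  have Hn := hom_ract M; have [HM _] := Ht M; rewrite /= in HM.
  have Hzm := hom_hb Z (rob M).
  have Hr : Hom (c := rmodules A) (rmodule_act (rob M) regular_module) M (ract M).
    by split=> //=; rewrite ract_mul.
  have := ct (rob M) regular_module; rewrite /compatible_at /=.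
  change (@comp (modcat (rmodules A))) with (@comp C).
  have [Hrm _] := Ht (rmodule_act (rob M) regular_module); rewrite /= in Hrm.
  rewrite (comp1r Hrm (tensA _ _ _)).
  erewrite comp1r; try sides.
  have := nt _ _ _ Hr; rewrite /=.
  change (@comp (modcat (rmodules A))) with (@comp C).
  move=> en ec; rewrite ec in en.
  transitivity (t M ∘ (hob Z ◁ ract M) ∘ (hob Z ◁ rob M ◁ one A)).
    assr; erewrite <- whl_comp; try sides.
    by rewrite ract_one tensm_id; erewrite comp1r; try sides.
  rewrite en /z; whisk; assr.
  rewrite (tensmA _ (idm (rob M)) (one A)) tensm_id.
  erewrite slider; try sides.
  rewrite (tensmA _ (idm (hob Z)) (one A)) tensm_id.
  by have := slidel Hzm Ho eq_refl; rewrite tensm1r => ->.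
(* Centrality compares two formulas for [t] on the regular module: [e1] from right linearity, [e2]
   from the half-braiding. *)
have c : mul A ∘ (z ▷ aob A) = mul A ∘ (aob A ◁ z) ∘ hb Z (aob A).
  by rewrite -e1 (e2 regular_module) /=; assr.
by exists (@CentralPair C A Z z Hz c).
Qed.

End ModulesOverAnAlgebra.

(** * Full centres of one algebra are isomorphic as algebras *)

Section FullCentreAlgebras.
Variables (C : strict_monoidal) (D : algebra C).

Lemma central_pair_restrict (P : central_pair D) W (f : Mor C) :
  Hom (c := centre C) W (cob P) f ->
  exists Q : central_pair D, cob Q = W /\ cmap Q = cmap P ∘ f.
Proof.
move=> [Hf Ef]; have Hc := hom_cmap P; have Hm := hom_mul D.
have H : Hom (hob W) (aob D) (cmap P ∘ f) by typ.
have E : mul D ∘ ((cmap P ∘ f) ▷ aob D)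
       = mul D ∘ (aob D ◁ (cmap P ∘ f)) ∘ hb W (aob D).
  whisk; assr; rewrite Ef; pull (mul D) (cmap P ▷ aob D).
  by rewrite cmap_central; assr.
by exists (@CentralPair C D W _ H E).
Qed.

(** In each homomorphism law both sides are morphisms of central pairs into [T'], from the square of
    [T] or from the unit pair, so terminality equates them. *)
Lemma full_centre_algebra_hom (T T' : full_centre D)
    (R R' : algebra (centre C)) (f : Mor C) :
  is_full_centre_algebra T R -> is_full_centre_algebra T' R' ->
  Hom (c := central_pairs D) T T' f -> Hom (c := algebras (centre C)) R R' f.
Proof.
case: R R' => [X m u Hm Hu a l r] [X' m' u' Hm' Hu' a' l' r'] [/= e h] [/= e' h'].
subst X X'; case: h => /= HT Em Eu; case: h' => /= HT' Em' Eu' [Hf Ef].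
have HmD := hom_mul D; rewrite /= in Ef.
have [Hm0 _] := Hm; have [Hu0 _] := Hu; have [Hf0 _] := Hf.
have [Hm0' _] := Hm'; have [Hu0' _] := Hu'.
rewrite /= in Hm0 Hu0 Hf0 Hm0' Hu0'.
change (Mor C) in m, u, m', u'.
split=> //=.
- apply: (@central_hom_unique C D T' (central_pair_tens T T)).
  + exact: (hom_comp (c := centre C) Hm Hf).
  + by rewrite /=; pull (cmap T') f; rewrite Ef Em.
  + exact: (hom_comp (c := centre C) (hom_tensm (s := centre C) Hf Hf) Hm').
  + rewrite /=; pull (cmap T') m'; rewrite Em'; assr.
    by erewrite tensmC; try sides; rewrite Ef.
- apply: (@central_hom_unique C D T' (central_pair_unit D)) => //=.
  + exact: (hom_comp (c := centre C) Hu Hf).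
  + by pull (cmap T') f; rewrite Ef Eu.
Qed.

Lemma full_centre_algebra_iso (T T' : full_centre D)
    (R R' : algebra (centre C)) :
  is_full_centre_algebra T R -> is_full_centre_algebra T' R' ->
  isomorphic (K := algebras (centre C)) R R'.
Proof.
move=> hR hR'.
have [f [Hf _]] := fc_terminal T' T; have [g [Hg _]] := fc_terminal T T'.
exists f, g; split.
- exact: full_centre_algebra_hom hR hR' Hf.
- exact: full_centre_algebra_hom hR' hR Hg.
- case: (hR) => /= -> _.
  have [H E] := hom_comp Hf Hg.
  have [H1 E1] := hom_id (c := central_pairs D) T.
  exact: central_hom_unique H E H1 E1.
- case: (hR') => /= -> _.
  have [H E] := hom_comp Hg Hf.
  have [H1 E1] := hom_id (c := central_pairs D) T'.
  exact: central_hom_unique H E H1 E1.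
Qed.

End FullCentreAlgebras.

(** * Matching central maps along a Morita equivalence *)

Section FullCentres.
Variables (C : strict_monoidal) (A B : algebra C).
Variable F : module_functor (rmodules A) (rmodules B).
Hypothesis eqF : is_equivalence F.

(** The object of the centre stays literally the same, so one arrow can serve as a morphism of pairs
    on both sides. *)
Definition matches (P : central_pair A) (Q : central_pair B) : Prop :=
  cob P = cob Q /\ intertwined F (hob (cob P)) (pair_action P) (pair_action Q).

Lemma matches_left (P : central_pair A) : exists Q, matches P Q.
Proof.
have [u [cu E]] := central_action_push eqF (pair_action_central P).
have [Q [e EQ]] := central_action_pair cu.
exists Q; split=> // M; rewrite E; congr comp; exact: EQ.
Qed.

Lemma matches_right (Q : central_pair B) : exists P, matches P Q.
Proof.
have [u [cu E]] := central_action_pull eqF (pair_action_central Q).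
have [P [e EP]] := central_action_pair cu.
exists P; split=> //; rewrite e => M; rewrite -E.
by congr (fmor F _ _ _); rewrite EP.
Qed.

Lemma matches_injl P P' Q : matches P Q -> matches P' Q -> cmap P = cmap P'.
Proof.
move=> [e E] [e' E'].
have eP : cob P = cob P' by rewrite e e'.
have [Ht _ _] := pair_action_central P.
have [Ht' _ _] := pair_action_central P'.
rewrite -eP in E' Ht'.
have := intertwined_injl eqF Ht Ht' E E' (regular_module A).
by rewrite -(pair_action_one P) -(pair_action_one P') eP => ->.
Qed.

Lemma matches_injr P Q Q' : matches P Q -> matches P Q' -> cmap Q = cmap Q'.
Proof.
move=> [e E] [e' E'].
have cQ := pair_action_central Q; have cQ' := pair_action_central Q'.
rewrite -e in cQ; rewrite -e' in cQ'.
have := intertwined_injr eqF cQ cQ' E E' (regular_module B).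
by rewrite -(pair_action_one Q) -(pair_action_one Q') -e -e' => ->.
Qed.

Lemma matches_restrict P Q P' Q' f :
  matches P Q -> cob P' = cob Q' -> Hom (c := central_pairs A) P' P f ->
  Hom (c := central_pairs B) Q' Q f -> matches P' Q'.
Proof.
move=> [e E] e' HP HQ; split=> // M.
have [Ht _ _] := pair_action_central P.
have [Hu _ _] := pair_action_central Q; rewrite -e in Hu.
have := intertwined_restrict Ht Hu (proj1 (proj1 HP)) E M.
by rewrite -(pair_action_restrict _ HP) -(pair_action_restrict _ HQ).
Qed.

Lemma matches_tens P Q P' Q' : matches P Q -> matches P' Q' ->
  matches (central_pair_tens P P') (central_pair_tens Q Q').
Proof.
move=> [e E] [e' E']; split=> [|M] /=; first by rewrite e e'.
have [Ht _ _] := pair_action_central P.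
have [Ht' _ _] := pair_action_central P'.
have [Hu _ _] := pair_action_central Q; rewrite -e in Hu.
have [Hu' _ _] := pair_action_central Q'; rewrite -e' in Hu'.
have := intertwined_tens Ht Ht' Hu Hu' E E' M.
by rewrite -!pair_action_tens {2}e {2}e' -pair_action_tens.
Qed.

Lemma matches_unit : matches (central_pair_unit A) (central_pair_unit B).
Proof.
split=> // M; rewrite !pair_action_unit; exact: intertwined_unit.
Qed.

(** Precomposing Q with [f] gives a pair [U] on the object of [Q']; both [U] and [Q'] match [P'], so
    their maps to B agree. *)
Lemma matches_hom_left P Q P' Q' f : matches P Q -> matches P' Q' ->
  Hom (c := central_pairs A) P' P f -> Hom (c := central_pairs B) Q' Q f.
Proof.
move=> h h' Hf; have [[e _] [e' _]] := (h, h'); have [Hf0 _] := Hf.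
have Hf1 : Hom (c := centre C) (cob Q') (cob Q) f by rewrite -e -e'.
have [U [eU EU]] := central_pair_restrict Hf1; split=> //.
rewrite -EU; apply: (matches_injr (P := P')) h'.
by apply: (matches_restrict h _ Hf); [rewrite eU | split; rewrite ?eU ?EU].
Qed.

Lemma matches_hom_right P Q P' Q' f : matches P Q -> matches P' Q' ->
  Hom (c := central_pairs B) Q' Q f -> Hom (c := central_pairs A) P' P f.
Proof.
move=> h h' Hf; have [[e _] [e' _]] := (h, h'); have [Hf0 _] := Hf.
have Hf1 : Hom (c := centre C) (cob P') (cob P) f by rewrite e e'.
have [U [eU EU]] := central_pair_restrict Hf1; split=> //.
rewrite -EU; apply: (matches_injl (Q := Q')) h'.
by apply: (matches_restrict h _ _ Hf); [rewrite eU | split; rewrite ?eU ?EU].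
Qed.

(** Every [W] has a partner [V], and the arrows from [W] to Q are exactly those from [V] to P. *)
Lemma matches_terminal P Q : matches P Q ->
  is_terminal (K := central_pairs A) P -> is_terminal (K := central_pairs B) Q.
Proof.
move=> h tP W; have [V hV] := matches_right W.
have [f [Hf Uf]] := tP V; exists f; split.
  exact: matches_hom_left h hV Hf.
by move=> g Hg; apply: Uf; apply: matches_hom_right h hV Hg.
Qed.

(** The homomorphism laws say that the multiplication and unit of R are morphisms to P from its
    square and from the unit pair; matching preserves such morphisms. *)
Lemma matches_alg_hom P Q (R : algebra (centre C)) : matches P Q ->
  aob R = cob P -> alg_hom (underlying_algebra R) A (cmap P) ->
  alg_hom (underlying_algebra R) B (cmap Q).
Proof.
case: R => [X m u Hm Hu a l r] h /= eX; subst X; move=> [/= HP Em Eu].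
have [e _] := h.
split=> /=; first by rewrite e; apply: hom_cmap.
- have [_ -> //] := matches_hom_left h (matches_tens h h) (conj Hm Em).
- have [_ -> //] := matches_hom_left h matches_unit (conj Hu Eu).
Qed.

End FullCentres.

Theorem corollary6p3 :
  forall (C : strict_monoidal) (A B : algebra C)
    (ZA : full_centre A) (ZB : full_centre B),
  morita_equivalent A B ->
  isomorphic (K := algebras (centre C))
    (full_centre_algebra ZA) (full_centre_algebra ZB).
Proof.
move=> C A B ZA ZB [F eqF].
have [Q h] := matches_left eqF ZA.
have [eR hR] := full_centre_algebraP ZA.
(* A second full centre of B, on the central object of [ZA], to be compared with [ZB]. *)
pose ZQ := FullCentre (matches_terminal eqF h (fc_terminal ZA)).
apply: (full_centre_algebra_iso (T := ZQ) (T' := ZB)).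
- split; first by rewrite eR; case: (h).
  exact: (matches_alg_hom eqF h eR hR).
- exact: full_centre_algebraP.
Qed.
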